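(* Let $\kappa\ge2$, $\lambda\ge0$ and $\tau$ be integers such that $\chi(J)\le\tau$ for every $\lambda$-spread digraph $J$ with $\omega(J)<\kappa$, and let $\Lambda=2\lambda^2+\lambda$. There exist $k_1,c_1\ge0$ such that the following holds: if $G$ is a $(4\Lambda\tau,k_1)$-robust $\lambda$-spread digraph with $\omega(G)\le\kappa$ such that no $(\lceil\kappa/2\rceil+1)$-clique of $G$ has a source, then $\chi(G)\le c_1$.
   Context: Digraphs are finite, with no loops, parallel edges or antiparallel pairs; $G^*$ is the underlying undirected graph, $\chi,\omega$ refer to $G^*$, and $\chi(Z)=\chi(G[Z])$. $N^+(v)$, $N^-(v)$ are the out- and in-neighbourhoods of $v$. A digraph $G$ is $\lambda$-spread if for every vertex $v$ and all $A\subseteq N^+(v)$, $B\subseteq N^-(v)$ with $|A|=|B|=\lambda$, some vertex of $A$ is $G^*$-adjacent with some vertex of $B$. A digraph $G$ is $(h,k)$-robust if for every nonempty $Z\subseteq V(G)$ with $\chi(Z)\le h$, some vertex of $Z$ has at least $k$ out-neighbours in $V(G)\setminus Z$ and at least $k$ in-neighbours in $V(G)\setminus Z$. A $k$-clique is a clique of $G^*$ of cardinality $k$; a source of a clique $X$ is a vertex of $X$ adjacent to every other vertex of $X$. *)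

(* Defs.v *)
(* A finite digraph is a vertex type T : finType with an arc
   relation E : rel T (E u v means arc u -> v). *)
From mathcomp Require Import all_boot.
Set Implicit Arguments. Unset Strict Implicit. Unset Printing Implicit Defensive.

(* no loops, no antiparallel pairs (parallel edges impossible for a relation) *)
Definition digraph (T : finType) (E : rel T) : Prop :=
  (forall v, ~~ E v v) /\ (forall u v, E u v -> ~~ E v u).

Definition adj (T : finType) (E : rel T) (u v : T) : bool := E u v || E v u.

Definition outN (T : finType) (E : rel T) (v : T) : {set T} := [set u | E v u].
Definition inN (T : finType) (E : rel T) (v : T) : {set T} := [set u | E u v].

Definition colorable (T : finType) (E : rel T) (Z : {set T}) (h : nat) : Prop :=
  exists f : T -> nat,
    (forall x, x \in Z -> f x < h) /\
    (forall x y, x \in Z -> y \in Z -> adj E x y -> f x != f y).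

Definition clique (T : finType) (E : rel T) (X : {set T}) : Prop :=
  forall x y, x \in X -> y \in X -> x != y -> adj E x y.

Definition omega_lt (T : finType) (E : rel T) (k : nat) : Prop :=
  forall X : {set T}, clique E X -> #|X| < k.

Definition source_of (T : finType) (E : rel T) (X : {set T}) (v : T) : Prop :=
  v \in X /\ forall u, u \in X -> u != v -> E v u.

Definition spread (T : finType) (E : rel T) (lam : nat) : Prop :=
  forall (v : T) (A B : {set T}),
    A \subset outN E v -> B \subset inN E v -> #|A| = lam -> #|B| = lam ->
    exists a b, [/\ a \in A, b \in B & adj E a b].

Definition robust (T : finType) (E : rel T) (h k : nat) : Prop :=
  forall Z : {set T}, Z != set0 -> colorable E Z h ->
    exists2 v, v \in Z &
      k <= #|outN E v :\: Z| /\ k <= #|inN E v :\: Z|.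

(* Main.v *)
Require Import Defs.
From mathcomp Require Import all_boot.
From mathcomp Require Import zify.
Set Implicit Arguments. Unset Strict Implicit. Unset Printing Implicit Defensive.

(* Call a vertex x of a set W returning if it has many in-neighbours in W and,
   for every t-set A of them, there are many out-neighbours U of x in W which
   are complete to a large part A' of A (all arcs going from U to A').

   If W is nonempty and all its vertices are returning, then long chains of
   large sets T_1, ..., T_j in W with all arcs going forward can be built:
   apply the property to a vertex of some T_i, i > 1, and to A = T_1.  By
   spreadness the resulting set U is adjacent to almost all of every T_i, and
   the arcs go from U to T_i, for otherwise U, A', T_i would form a cyclic
   triple of large complete sets, which robustness excludes.  A chain of
   kappa + 1 sets contradicts omega <= kappa.

   So every nonempty W has a vertex x which is not returning.  By the condition
   on sources, there is then a set B of bounded size such that no kappa-clique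
   of W containing x avoids B.  Removing such vertices one by one and colouring
   greedily in the reverse order gives a bounded number of colour classes
   without kappa-cliques, each of which is tau-colourable. *)

(** * Subsets of given size and the pigeonhole principle *)

Lemma subset_of_card (T : finType) (n : nat) (A : {set T}) :
  n <= #|A| -> exists2 B : {set T}, B \subset A & #|B| = n.
Proof.
elim: n => [|n IHn] ltnA; first by exists set0; rewrite ?sub0set ?cards0.
have [B sBA cardB] := IHn (ltnW ltnA).
have /subsetPn[x xA xNB] : ~~ (A \subset B).
  by apply: contraL ltnA => /subset_leq_card; rewrite cardB -leqNgt.
by exists (x |: B); rewrite ?cardsU1 ?xNB ?cardB // subUset sub1set xA.
Qed.

Lemma pigeonhole (T R : finType) (f : T -> R) (n : nat) (U : {set T}) (D : {set R}) :
  0 < #|D| -> {in U, forall x, f x \in D} -> n * #|D| <= #|U| ->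
  exists r, n <= #|[set x in U | f x == r]|.
Proof.
move=> D0 fD leU; case: n leU => [|n] leU.
  by case/card_gt0P: D0 => r _; exists r.
have /existsP // : [exists r, n < #|[set x in U | f x == r]|].
apply: contraLR leU; rewrite negb_exists => /forallP small.
rewrite -ltnNge -sum1_card (partition_big f (mem D)) //=.
apply: leq_ltn_trans (_ : n * #|D| < _); last by rewrite ltn_pmul2r.
rewrite mulnC -sum_nat_const; apply: leq_sum => r _.
rewrite sum1dep_card; have := small r; rewrite -leqNgt; apply: leq_trans.
by apply/eq_leq/eq_card => x; rewrite !inE.
Qed.

(** * Colourings of vertex sets and of induced subdigraphs *)

Section Coloring.
Variables (T : finType) (E : rel T).
Implicit Types Z : {set T}.

Lemma colorable_sub Z Z' h h' :
  Z' \subset Z -> h <= h' -> colorable E Z h -> colorable E Z' h'.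
Proof.
move=> /subsetP sZ leh [f [fh fE]]; exists f; split=> [x /sZ xZ|x y /sZ ? /sZ ?].
  exact: leq_trans (fh x xZ) leh.
exact: fE.
Qed.

Lemma colorableU Z1 Z2 h1 h2 :
  colorable E Z1 h1 -> colorable E Z2 h2 -> colorable E (Z1 :|: Z2) (h1 + h2).
Proof.
move=> [f [fh fE]] [g [gh gE]].
exists (fun x => if x \in Z1 then f x else h1 + g x); split=> [x|x y].
  rewrite inE; case: ifP => [xZ _|_ /= xZ].
    by apply: leq_trans (fh x xZ) _; apply: leq_addr.
  by rewrite ltn_add2l gh.
rewrite !inE; case: ifP => xZ; case: ifP => yZ //= ? ? xy.
- exact: fE.
- by have := fh x xZ; lia.
- by have := fh y yZ; lia.
- by rewrite eqn_add2l gE.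
Qed.

Lemma colorable_bigcup (I : eqType) (s : seq I) (F : I -> {set T}) h :
  {in s, forall i, colorable E (F i) h} ->
  colorable E (\bigcup_(i <- s) F i) (size s * h).
Proof.
elim: s => [|i s IHs] colF.
  by rewrite big_nil; exists (fun=> 0); split=> x; rewrite inE.
rewrite big_cons mulSn; apply: colorableU; first by apply: colF; rewrite mem_head.
by apply: IHs => j js; apply: colF; rewrite inE js orbT.
Qed.

Lemma adjC u v : adj E u v = adj E v u.
Proof. by rewrite /adj orbC. Qed.

Lemma clique_sub (X Y : {set T}) : X \subset Y -> clique E Y -> clique E X.
Proof. by move=> /subsetP sXY cY x y /sXY xY /sXY; apply: cY. Qed.

Hypothesis Edi : digraph E.

(** The hypothesis on [tau] colours whole digraphs; it reaches subsets because spreadness passes to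
    the digraph induced on the subtype of [Z]. *)
Lemma induced_colorable lam kappa tau Z :
  (forall (J : finType) (EJ : rel J), digraph EJ -> spread EJ lam ->
     omega_lt EJ kappa -> colorable EJ setT tau) ->
  spread E lam -> (forall X : {set T}, X \subset Z -> clique E X -> #|X| < kappa) ->
  colorable E Z tau.
Proof.
move=> htau Espread Zomega.
pose J : finType := {x | x \in Z}; pose EJ : rel J := fun u v => E (val u) (val v).
have im_card (A : {set J}) : #|val @: A| = #|A| by apply: card_imset val_inj.
have [|||f [fh fE]] := htau J EJ.
- by case: Edi => Eirr Easym; split=> [v|u v]; [apply: Eirr|apply: Easym].
- move=> v A B sA sB cA cB.
  have [||||_ [_ [/imsetP[a aA ->] /imsetP[b bB ->] ab]]] :=
    Espread (val v) (val @: A) (val @: B); rewrite ?im_card //.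
  + by apply/subsetP => _ /imsetP[a /(subsetP sA) va ->]; move: va; rewrite !inE.
  + by apply/subsetP => _ /imsetP[a /(subsetP sB) va ->]; move: va; rewrite !inE.
  by exists a, b.
- move=> X cX; rewrite -im_card; apply: Zomega.
    by apply/subsetP => _ /imsetP[x _ ->]; apply: valP.
  by move=> _ _ /imsetP[x xX ->] /imsetP[y yX ->] xy; apply: cX.
exists (fun x => if insub x is Some u then f u else 0); split=> [x xZ|x y xZ yZ xy].
  by rewrite (insubT (mem Z) xZ) fh ?inE.
by rewrite (insubT (mem Z) xZ) (insubT (mem Z) yZ) fE ?inE.
Qed.

End Coloring.

(** * Homogeneous sets, complete pairs and spreadness *)

Section Digraph.
Variables (T : finType) (E : rel T).

Definition homogeneous (S U : {set T}) : Prop :=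
  forall s u u', s \in S -> u \in U -> u' \in U -> E s u = E s u' /\ E u s = E u' s.

(** Classify [u] by the traces on [S] of its out- and in-neighbourhoods: there are
    [2 ^ #|S| * 2 ^ #|S|] classes, each homogeneous. *)
Lemma homogeneous_subset (S U : {set T}) n :
  n * (2 ^ #|S| * 2 ^ #|S|) <= #|U| ->
  exists U' : {set T}, [/\ U' \subset U, #|U'| = n & homogeneous S U'].
Proof.
move=> leU; pose f u := (S :&: outN E u, S :&: inN E u).
pose D := setX (powerset S) (powerset S).
have cD : #|D| = 2 ^ #|S| * 2 ^ #|S| by rewrite cardsX card_powerset.
have [|||r] := @pigeonhole _ _ f n U D.
- by rewrite cD -expnD expn_gt0.
- by move=> x _; rewrite !inE /= !subsetIl.
- by rewrite cD.
case/subset_of_card => U' /subsetP sU' cU'; exists U'; split=> //.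
  by apply/subsetP => u /sU'; rewrite inE => /andP[].
move=> s u u' sS /sU'; rewrite inE => /andP[_ /eqP fu].
move=> /sU'; rewrite inE => /andP[_ /eqP]; rewrite -fu => -[/setP/(_ s) + /setP/(_ s)].
by rewrite !inE sS.
Qed.

Definition complete (A B : {set T}) : bool := [forall a in A, B \subset outN E a].

Lemma completeP (A B : {set T}) :
  reflect {in A & B, forall a b, E a b} (complete A B).
Proof.
apply: (iffP forall_inP) => [AB a b /AB/subsetP/[apply]|AB a aA]; first by rewrite inE.
by apply/subsetP => b bB; rewrite inE AB.
Qed.

Lemma complete_sub (A A' B B' : {set T}) :
  A' \subset A -> B' \subset B -> complete A B -> complete A' B'.
Proof.
move=> /subsetP sA /subsetP sB /completeP AB; apply/completeP => a b /sA aA /sB.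
exact: AB.
Qed.

Definition hits lam (X : {set T}) z : bool :=
  (lam <= #|X :&: inN E z|) || (lam <= #|X :&: outN E z|).

Variable lam : nat.
Hypothesis Espread : spread E lam.

Lemma spread_nonadj v (U B : {set T}) :
  U \subset outN E v -> B \subset inN E v -> lam <= #|U| ->
  {in B & U, forall b u, ~~ adj E b u} -> #|B| < lam.
Proof.
move=> sU sB /subset_of_card[U' sU' cU'] BU; rewrite ltnNge; apply/negP.
case/subset_of_card=> B' sB' cB'.
have [u [b [uU bB]]] :=
  Espread (subset_trans sU' sU) (subset_trans sB' sB) cU' cB'.
by apply/negP; rewrite adjC BU // ?(subsetP sU') ?(subsetP sB').
Qed.

(** More than [2 * lam] vertices of [Y] are adjacent to [u], so at least [lam] of them lie on one
    side. *)
Lemma hits_of_nonadj (Y : {set T}) u :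
  3 * lam <= #|Y| -> #|[set y in Y | ~~ adj E y u]| < lam -> hits lam Y u.
Proof.
move=> cY nonadj; rewrite /hits.
have : #|Y| <= #|Y :&: inN E u| + #|Y :&: outN E u| + #|[set y in Y | ~~ adj E y u]|.
  apply: leq_trans (leq_add (leq_card_setU _ _) (leqnn _)).
  apply: leq_trans (leq_card_setU _ _); apply/subset_leq_card/subsetP => y yY.
  by rewrite !inE yY /adj; case: (E y u); case: (E u y).
by move: cY nonadj; case: ltnP; case: ltnP => //; lia.
Qed.

End Digraph.

(** * Arc reversal and the exclusion of cyclic triples *)

Lemma spread_rev (T : finType) (E : rel T) lam :
  spread E lam -> spread (fun u v => E v u) lam.
Proof.
move=> Espread v A B sA sB cA cB.
have [b [a [bB aA ab]]] := Espread v B A sB sA cB cA.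
by exists a, b; split=> //; rewrite /adj.
Qed.

(* Some [b] in [X] is adjacent to the whole homogeneous set [U]; as the
   predecessors [Y] and the successors [Y'] of [b] lie on the two sides of [b],
   spreadness at [b] makes [U] adjacent to almost all of one of them. *)
Lemma hits_generic_out (T : finType) (E : rel T) lam z (X Y Y' U : {set T}) :
  spread E lam -> 0 < lam -> lam <= #|X :&: inN E z| -> U \subset outN E z ->
  lam <= #|U| -> homogeneous E (X :|: Y :|: Y') U ->
  complete E Y X -> complete E X Y' -> 3 * lam <= #|Y| -> 3 * lam <= #|Y'| ->
  {in U, forall u, hits E lam Y u || hits E lam Y' u}.
Proof.
move=> Espread lam0 cX sU cU hU YX XY' cY cY' u uU.
(* This is spreadness at [z], with [U] among its out-neighbours and [lam] of its in-neighbours in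
   [X]. *)
have /exists_inP[b bX /exists_inP[u' u'U bu']] :
    [exists b in X :&: inN E z, [exists u in U, adj E b u]].
  apply: contraLR cX => /exists_inPn noadj; rewrite -ltnNge.
  apply: (spread_nonadj Espread sU) => // [|b u' bX u'U]; first exact: subsetIr.
  by have /exists_inPn/(_ _ u'U) := noadj b bX.
move: bX; rewrite inE => /andP[bX _].
have bS : b \in X :|: Y :|: Y' by rewrite !inE bX.
(* By homogeneity all of [U] lies on the same side of [b] as [u']; a vertex of [Y] or [Y']
   nonadjacent to [u] is nonadjacent to all of [U]. *)
case/orP: bu' => bu'; apply/orP; [left|right]; apply: hits_of_nonadj => //.
- apply: (spread_nonadj Espread (v := b) (U := U)) => //.
  + by apply/subsetP => w wU; rewrite inE (hU b w u' bS wU u'U).1.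
  + apply/subsetP => y; rewrite !inE => /andP[yY _].
    by move/completeP: YX; apply.
  + move=> y w; rewrite !inE => /andP[yY] + wU.
    have yS : y \in X :|: Y :|: Y' by rewrite !inE yY orbT.
    by rewrite /adj; have [-> ->] := hU y u w yS uU wU.
- apply: (spread_nonadj (spread_rev Espread) (v := b) (U := U)) => //.
  + by apply/subsetP => w wU; rewrite inE (hU b w u' bS wU u'U).2.
  + apply/subsetP => y; rewrite !inE => /andP[yY _].
    by move/completeP: XY'; apply.
  + move=> y w; rewrite !inE => /andP[yY] + wU.
    have yS : y \in X :|: Y :|: Y' by rewrite !inE yY !orbT.
    by rewrite /adj orbC; have [-> ->] := hU y u w yS uU wU.
Qed.

Lemma hits_rev (T : finType) (E : rel T) lam (X : {set T}) z :
  hits (fun u v => E v u) lam X z = hits E lam X z.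
Proof. by rewrite /hits orbC. Qed.

Lemma complete_rev (T : finType) (E : rel T) (A B : {set T}) :
  complete E A B -> complete (fun u v => E v u) B A.
Proof. by move=> /completeP AB; apply/completeP => b a bB aA; apply: AB. Qed.

Lemma homogeneous_rev (T : finType) (E : rel T) (S U : {set T}) :
  homogeneous E S U -> homogeneous (fun u v => E v u) S U.
Proof. by move=> hU s u u' sS uU u'U; have [] := hU s u u' sS uU u'U. Qed.

(* Robustness is applied to the set [Z] of vertices with [lam] in-neighbours or
   [lam] out-neighbours in one part: a vertex of [Z] with [lam] in-neighbours
   (out-neighbours) in a part has almost all its out-neighbours
   (in-neighbours) in [Z]. *)
Lemma no_cyclic_triple (T : finType) (E : rel T) lam tau h k (A B C : {set T}) :
  spread E lam -> 0 < lam -> (forall v, colorable E (inN E v :|: outN E v) tau) ->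
  9 * lam * tau <= h -> lam * (2 ^ (9 * lam) * 2 ^ (9 * lam)) <= k ->
  robust E h k ->
  complete E A B -> complete E B C -> complete E C A ->
  3 * lam <= #|A| -> 3 * lam <= #|B| -> 3 * lam <= #|C| -> False.
Proof.
move=> Espread lam0 colN leh lek Erob AB BC CA.
(* Trimming the parts to exactly [3 * lam] bounds their union by [9 * lam], the factor in [h] and
   the exponent in [k]. *)
case/subset_of_card=> A' sA cA; case/subset_of_card=> B' sB cB.
case/subset_of_card=> C' sC cC.
have {AB}AB := complete_sub sA sB AB; have {BC}BC := complete_sub sB sC BC.
have {CA}CA := complete_sub sC sA CA; move: A' B' C' {A B C sA sB sC} cA cB cC AB BC CA.
move=> A B C cA cB cC AB BC CA.
pose S := A :|: B :|: C.
have cS : #|S| <= 9 * lam.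
  apply: leq_trans (leq_card_setU _ _) _; rewrite cC.
  by have := (leq_card_setU A B).1; rewrite cA cB; lia.
pose Z := [set z | [|| hits E lam A z, hits E lam B z | hits E lam C z]].
(* As [lam] is positive, each vertex of [Z] is a neighbour of some vertex of [S]. *)
have colZ : colorable E Z h.
  have := @colorable_bigcup T E _ (enum S) (fun v => inN E v :|: outN E v) tau.
  rewrite big_enum -cardE /= => /(_ (fun v _ => colN v)).
  apply: colorable_sub; last by apply: leq_trans leh; rewrite leq_mul2r cS orbT.
  have hitS (X : {set T}) z : X \subset S -> hits E lam X z ->
      z \in \bigcup_(i in S) (inN E i :|: outN E i).
    move=> /subsetP sX /orP[] /(leq_trans lam0) /card_gt0P[x];
      rewrite inE => /andP[/sX xS]; rewrite inE => xz;
      by apply/bigcupP; exists x => //; rewrite !inE xz ?orbT.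
  apply/subsetP => z; rewrite inE => /or3P[]; apply: hitS.
  - by rewrite /S -setUA subsetUl.
  - by rewrite /S setUAC subsetUr.
  - by rewrite subsetUr.
have Zn0 : Z != set0.
  have /card_gt0P[a aA] : 0 < #|A| by lia.
  apply/set0Pn; exists a; rewrite inE /hits; apply/or3P/Or32/orP; right.
  rewrite (setIidPl _) ?cB; first by lia.
  by apply/subsetP => b bB; rewrite inE; move/completeP: AB; apply.
have [z zZ [kout kin]] := Erob Z Zn0 colZ.
have getU (F : {set T}) : k <= #|F :\: Z| ->
    exists U : {set T}, [/\ U \subset F :\: Z, #|U| = lam & homogeneous E S U].
  move=> kF; apply: homogeneous_subset; apply: leq_trans kF; apply: leq_trans lek.
  by rewrite leq_mul2l leq_mul ?orbT ?leq_pexp2l.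
have clash (Y Y' U F : {set T}) :
    U \subset F :\: Z -> #|U| = lam ->
    {in U, forall u, hits E lam Y u || hits E lam Y' u} ->
    (forall u, hits E lam Y u -> u \in Z) -> (forall u, hits E lam Y' u -> u \in Z) ->
    False.
  move=> /subsetP sU cU hitU ZY ZY'; have /card_gt0P[u uU] : 0 < #|U| by rewrite cU.
  have := sU u uU; rewrite inE => /andP[/negP uZ _]; apply: uZ.
  by case/orP: (hitU u uU) => [/ZY|/ZY'].
have hitZ : forall u, [/\ hits E lam A u -> u \in Z, hits E lam B u -> u \in Z
    & hits E lam C u -> u \in Z].
  by move=> u; split=> hu; rewrite inE hu ?orbT.
(* [X] is the part hit by [z], preceded by [Y] and followed by [Y'] in the cycle. A set [U] on the
   opposite side of [z], chosen outside [Z], is forced into [Z]. Reversing the arcs exchanges [Y]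
   and [Y']. *)
have main (X Y Y' : {set T}) : Y :|: X :|: Y' = S -> complete E Y X -> complete E X Y' ->
    #|Y| = 3 * lam -> #|Y'| = 3 * lam ->
    (forall u, hits E lam Y u -> u \in Z) -> (forall u, hits E lam Y' u -> u \in Z) ->
    hits E lam X z -> False.
  move=> defS YX XY' cY cY' ZY ZY' /orP[] hX.
  - have [U [sU cU hU]] := getU _ kout.
    apply: (clash Y Y' U _ sU cU _ ZY ZY').
    apply: (hits_generic_out Espread lam0 hX) => //; rewrite ?cU ?cY ?cY' //.
      by apply: subset_trans sU (subsetDl _ _).
    by rewrite [X :|: Y]setUC defS.
  - have [U [sU cU hU]] := getU _ kin.
    apply: (clash Y' Y U _ sU cU _ ZY' ZY) => u uU.
    rewrite -(hits_rev E lam Y') -(hits_rev E lam Y).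
    have sUz : U \subset outN (fun u v => E v u) z := subset_trans sU (subsetDl _ _).
    apply: (hits_generic_out (spread_rev Espread) lam0 hX sUz _ _
      (complete_rev XY') (complete_rev YX)); rewrite ?cU ?cY ?cY' //.
    by apply: homogeneous_rev; rewrite setUAC [X :|: Y]setUC defS.
move: zZ; rewrite inE => /or3P[].
- apply: (main A C B); rewrite ?cB ?cC //; try by move=> u; have [] := hitZ u.
  by apply/setP => v; rewrite !inE; do !case: (v \in _).
- by apply: (main B A C); rewrite ?cA ?cC //; move=> u; have [] := hitZ u.
- apply: (main C B A); rewrite ?cB ?cA //; try by move=> u; have [] := hitZ u.
  by apply/setP => v; rewrite !inE; do !case: (v \in _).
Qed.

(** * Chains of complete sets and returning vertices *)

Section Chains.
Variables (T : finType) (E : rel T).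

(** Take one vertex from each part. The inclusion of [K] in the union makes the next vertex dominate
    [K], hence lie outside it, as there are no loops. *)
Lemma complete_chain_clique (s : seq {set T}) :
  (forall v, ~~ E v v) -> pairwise (complete E) s -> all (fun X : {set T} => 0 < #|X|) s ->
  exists K : {set T}, [/\ clique E K, #|K| = size s & K \subset \bigcup_(X <- s) X].
Proof.
move=> Eirr; elim: s => [|X s IHs] /=.
  by exists set0; rewrite cards0 sub0set; split=> // x y; rewrite inE.
case/andP=> Xs /IHs{}IHs /andP[/card_gt0P[x xX] /IHs[K [cK sizeK sK]]].
have xK y : y \in K -> E x y.
  move/(subsetP sK); rewrite (big_nth set0) big_mkord => /bigcupP[i _ yi].
  by have /allP/(_ _ (mem_nth set0 (ltn_ord i)))/completeP := Xs; apply.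
exists (x |: K); split.
- move=> y z; rewrite !inE => /orP[/eqP->|yK] /orP[/eqP->|zK]; rewrite ?eqxx //.
  + by rewrite /adj xK.
  + by rewrite /adj xK ?orbT.
  + exact: cK.
- by rewrite cardsU1 sizeK; case: (boolP (x \in K)) => // /xK; rewrite (negPf (Eirr x)).
- rewrite big_cons subUset sub1set inE xX /=.
  exact: subset_trans sK (subsetUr _ _).
Qed.

(** The first conjunct keeps the second from holding vacuously. *)
Definition returning t tp N (W : {set T}) x : bool :=
  (t <= #|inN E x :&: W|) &&
  [forall (A : {set T} | (A \subset inN E x :&: W) && (#|A| == t)),
    [exists U : {set T}, [exists A' : {set T},
      [&& U \subset outN E x :&: W, N <= #|U|, A' \subset A, tp <= #|A'|
        & complete E U A']]]].

Lemma returningP t tp N (W A : {set T}) x :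
  returning t tp N W x -> A \subset inN E x :&: W -> #|A| = t ->
  exists U A' : {set T}, [/\ U \subset outN E x :&: W, N <= #|U|, A' \subset A,
    tp <= #|A'| & complete E U A'].
Proof.
case/andP=> _ /forall_inP/(_ A) + sA cA; rewrite sA cA eqxx => /(_ isT).
by case/existsP=> U /existsP[A' /and5P[? ? ? ? ?]]; exists U, A'.
Qed.

Variables (lam m t tp N : nat).
Hypothesis Espread : spread E lam.
Hypothesis acyclic : forall A B C : {set T},
  complete E A B -> complete E B C -> complete E C A ->
  3 * lam <= #|A| -> 3 * lam <= #|B| -> 3 * lam <= #|C| -> False.
Hypotheses (le_lam_tp : 3 * lam <= tp) (le_tp_t : tp <= t).

Hypothesis le_N : t * (2 ^ (m * t) * 2 ^ (m * t)) <= N.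

(* The new first part [U] consists of out-neighbours of a vertex [v] of the
   tail [s], so [v] itself is lost; a part [Y] of the tail cannot send many arcs
   to [U], as [Y], [U] and [F'] would form a cyclic triple. *)
Lemma extend_chain (W F : {set T}) (s : seq {set T}) d :
  {in W, forall x, returning t tp N W x} ->
  0 < size s <= m -> pairwise (complete E) (F :: s) -> #|F| = t -> 0 < d <= tp ->
  all (fun X : {set T} => X \subset W) (F :: s) ->
  all (fun X : {set T} => d + 4 * lam <= #|X| <= t) s ->
  exists F' (s' : seq {set T}), [/\ size s' = (size s).+1, pairwise (complete E) (F' :: s'),
    #|F'| = t, all (fun X : {set T} => X \subset W) (F' :: s')
    & all (fun X : {set T} => d <= #|X| <= t) s'].
Proof.
move=> retW /andP[s_gt0 le_sm] /= /andP[Fs pws] cF /andP[d_gt0 le_dtp] /andP[sFW sW] cs.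
have tp_gt0 : 0 < tp := leq_trans d_gt0 le_dtp.
have le_lam_t : 3 * lam <= t := leq_trans le_lam_tp le_tp_t.
have [X sX] : exists X, X \in s by case: (s) s_gt0 => // X s' _; exists X; rewrite mem_head.
have /card_gt0P[v vX] : 0 < #|X| by have /allP/(_ _ sX) := cs; lia.
have vW : v \in W by have /allP/(_ _ sX)/subsetP := sW; apply.
have FX : complete E F X by have /allP := Fs; apply.
have sFv : F \subset inN E v :&: W.
  by rewrite subsetI sFW andbT; apply/subsetP => f fF; rewrite inE; move/completeP: FX; apply.
have [U0 [F' [sU0 cU0 sF' cF' U0F']]] := returningP (retW v vW) sFv cF.
pose S := \bigcup_(Y <- s) Y.
have cS : #|S| <= m * t.
  apply: leq_trans (_ : size s * t <= _); last by rewrite leq_mul2r le_sm orbT.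
  rewrite /S; elim: (s) cs => [|Y r IHr] /=; first by rewrite big_nil cards0.
  case/andP=> /andP[_ cY] /IHr{}IHr; rewrite big_cons mulSn.
  by apply: leq_trans (leq_card_setU _ _) _; apply: leq_add.
have [U [sUU0 cU hU]] : exists U : {set T}, [/\ U \subset U0, #|U| = t & homogeneous E S U].
  apply: homogeneous_subset; apply: leq_trans (leq_trans le_N cU0).
  by rewrite leq_mul2l leq_mul ?orbT ?leq_pexp2l.
clear le_N cU0.
have UF' : complete E U F' by apply: complete_sub U0F'.
have /subsetIP[_ sUW] : U \subset outN E v :&: W by apply: subset_trans sU0.
pose dom (Y : {set T}) := [set y in Y | [forall u in U, E u y]].
have sdom Y : dom Y \subset Y by apply/subsetP => y; rewrite inE => /andP[].
(* The loss [4 * lam] has two sources. At most [lam] vertices of [Y] are nonadjacent to [U], by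
   spreadness at a vertex of [F'], which lies between [U] and [Y]. At most [3 * lam] dominate [U],
   by [acyclic]. By homogeneity the others are dominated by [U]. *)
have cdom Y : Y \in s -> #|Y| <= #|dom Y| + 4 * lam.
  move=> sY; have F'Y : complete E F' Y.
    by apply: (complete_sub sF' (subxx Y)); have /allP := Fs; apply.
  have YS y : y \in Y -> y \in S.
    by move=> yY; rewrite /S (big_rem Y) //= inE yY.
  pose Y1 := [set y in Y | [forall u in U, ~~ adj E y u]].
  pose Y2 := [set y in Y | [forall u in U, E y u]].
  have /card_gt0P[u uU] : 0 < #|U| by rewrite cU (leq_trans tp_gt0).
  have cY1 : #|Y1| <= lam.
    have /card_gt0P[f fF'] : 0 < #|F'| by apply: leq_trans cF'.
    apply: ltnW; apply: (spread_nonadj (spread_rev Espread) (v := f) (U := U)).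
    - by apply/subsetP => w wU; rewrite inE; move/completeP: UF'; apply.
    - apply/subsetP => y; rewrite !inE => /andP[yY _].
      by move/completeP: F'Y; apply.
    - by rewrite cU; apply: leq_trans le_lam_t; rewrite leq_pmull.
    - move=> y w; rewrite inE => /andP[_ /forall_inP/[apply]].
      by rewrite /adj orbC.
  have cY2 : #|Y2| <= 3 * lam.
    rewrite leqNgt; apply/negP => /ltnW cY2.
    apply: (@acyclic Y2 U F') => //; first 1 last.
    - by apply: complete_sub F'Y => //; apply/subsetP => y; rewrite inE => /andP[].
    - by rewrite cU.
    - exact: leq_trans cF'.
    by apply/completeP => y w; rewrite inE => /andP[_ /forall_inP]; apply.
  have : #|Y| <= #|dom Y| + #|Y1| + #|Y2|.
    apply: leq_trans (leq_add (leq_card_setU _ _) (leqnn _)).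
    apply: leq_trans (leq_card_setU _ _); apply/subset_leq_card/subsetP => y yY.
    have hy w : w \in U -> E y w = E y u /\ E w y = E u y.
      by move=> wU; apply: hU; rewrite ?YS.
    rewrite !inE yY /=; case Eyu: (E y u).
      by apply/orP; right; apply/forall_inP => w /hy[-> _].
    apply/orP; left; case Euy: (E u y); apply/orP; [left|right].
      by apply/forall_inP => w /hy[_ ->].
    by apply/forall_inP => w /hy[yw wy]; rewrite /adj yw wy Eyu Euy.
  by move: cY1 cY2; clear; lia.
exists U, (F' :: map dom s); split=> //=.
- by rewrite size_map.
- rewrite UF' !all_map pairwise_map /=; apply/and3P; split.
  + apply/allP => Y sY /=; apply/completeP => u y uU.
    by rewrite inE => /andP[_ /forall_inP]; apply.
  + apply/allP => Y sY /=; apply: (complete_sub sF' (sdom Y)).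
    by have /allP := Fs; apply.
  + by apply: sub_pairwise pws => Y Y'; apply: complete_sub.
- rewrite sUW (subset_trans sF' sFW) all_map /=; apply/allP => Y sY /=.
  by apply: subset_trans (sdom Y) _; have /allP := sW; apply.
- have cF't : #|F'| <= t by rewrite -cF subset_leq_card.
  rewrite all_map (leq_trans le_dtp cF') cF't /=.
  apply/allP => Y sY /=; have /allP/(_ _ sY) /= := cs; have := cdom Y sY.
  by have := subset_leq_card (sdom Y); clear; lia.
Qed.

Lemma returning_clique (W : {set T}) :
  (forall v, ~~ E v v) -> 0 < m -> 4 * lam * m + 1 <= tp -> W != set0 ->
  {in W, forall x, returning t tp N W x} ->
  exists K : {set T}, clique E K /\ #|K| = m.+1.
Proof.
move=> Eirr m_gt0 le_tp /set0Pn[x xW] retW.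
(* Each part of the tail keeps [4 * lam] vertices for every extension still to come, plus one to
   survive at the end. *)
have chain n : n < m -> exists F (s : seq {set T}),
    [/\ size s = n.+1, pairwise (complete E) (F :: s), #|F| = t,
      all (fun X : {set T} => X \subset W) (F :: s)
    & all (fun X : {set T} => 4 * lam * (m - n.+1) + 1 <= #|X| <= t) s].
  elim: n => [|n IHn] lt_nm.
    have /andP[/subset_of_card[A sA cA] _] := retW x xW.
    have [U [A' [sU cU sA' cA' UA']]] := returningP (retW x xW) sA cA.
    have /subset_of_card[F sF cF] : t <= #|U|.
      by apply: leq_trans (leq_trans le_N cU); rewrite leq_pmulr // -expnD expn_gt0.
    exists F, [:: A']; split=> //=.
    - by rewrite !andbT; apply: complete_sub UA'.
    - move/subsetIP: sA => [_ /(subset_trans sA')->].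
      by move/subsetIP: sU => [_ /(subset_trans sF)->].
    - by rewrite -cA (subset_leq_card sA') !andbT; apply: leq_trans cA'; nia.
  have [F [s [ss pws cF sW cs]]] := IHn (ltnW lt_nm).
  have extend := @extend_chain W F s (4 * lam * (m - n.+2) + 1) retW _ pws cF _ sW _.
  clear le_N; have [|||F' [s' [ss' pws' cF' sW' cs']]] := extend.
  - by rewrite ss; exact: ltnW.
  - by apply/andP; split; nia.
  - apply: sub_all cs => X /andP[cX ->]; rewrite andbT; apply: leq_trans cX.
    by rewrite (_ : m - n.+1 = (m - n.+2).+1) ?mulnS; move: lt_nm; clear; lia.
  by exists F', s'; rewrite ss' ss.
(* The tail then has [m] parts, and the head [F] is the part number [m.+1]. *)
clear le_N; have [F [s [ss pws cF _ cs]]] := chain m.-1 ltac:(lia).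
have [|K [cK sizeK _]] := complete_chain_clique Eirr pws.
  rewrite /= cF; apply/andP; split; first by lia.
  by apply: sub_all cs => X; lia.
by exists K; split=> //; rewrite sizeK /= ss; lia.
Qed.

End Chains.

(** * Cliques without sources and exceptional sets *)

Lemma card_bigcup_le (T I : finType) (P : {set I}) (F : I -> {set T}) n :
  {in P, forall i, #|F i| <= n} -> #|\bigcup_(i in P) F i| <= #|P| * n.
Proof.
move=> leF; apply: leq_trans (_ : \sum_(i in P) #|F i| <= _); last first.
  by rewrite -sum_nat_const; apply: leq_sum.
elim/big_ind2: _ => [|k A l B kA lB|//]; first by rewrite cards0.
exact: leq_trans (leq_card_setU _ _) (leq_add kA lB).
Qed.

(** Exchanging the sums turns one of the two copies into in-degrees; in- and out-degree in a clique
    add up to at least [#|X|.-1] at each vertex. *)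
Lemma clique_out_degrees (T : finType) (E : rel T) (X : {set T}) :
  clique E X -> #|X| * #|X|.-1 <= 2 * \sum_(x in X) #|X :&: outN E x|.
Proof.
move=> cX.
have degE x : #|X :&: outN E x| = \sum_(y in X) E x y.
  rewrite -sum1_card big_mkcond [RHS]big_mkcond /=; apply: eq_bigr => y _.
  by rewrite !inE; case: (y \in X); case: (E x y).
rewrite mul2n -addnn (eq_bigr _ (fun x _ => degE x)) {2}exchange_big -big_split /=.
rewrite -sum_nat_const; apply: leq_sum => x xX; rewrite -big_split /= (cardsD1 x) xX /=.
rewrite -sum1_card big_mkcond [leqRHS]big_mkcond /=; apply: leq_sum => y _.
rewrite !inE; case: eqVneq => //= ynx; case: (boolP (y \in X)) => // yX.
by have := cX x y xX yX; rewrite eq_sym => /(_ ynx); rewrite /adj; do 2!case: (E _ _).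
Qed.

Section Sources.
Variables (T : finType) (E : rel T) (kappa lam : nat).
Hypothesis Eirr : forall v, ~~ E v v.
Hypothesis Espread : spread E lam.
Hypothesis kappa_ge2 : 2 <= kappa.
Hypothesis no_source : forall X : {set T}, clique E X -> #|X| = (kappa.+1)./2 + 1 ->
  forall v, ~ source_of E X v.

(** Otherwise [v] would be a source of a clique on itself and [(kappa.+1)./2] vertices of [Y]; this
    number is half of [kappa], rounded up. *)
Lemma out_clique_small (Y : {set T}) v :
  clique E Y -> Y \subset outN E v -> #|Y| < (kappa.+1)./2.
Proof.
move=> cY sY; rewrite ltnNge; apply/negP => /subset_of_card[Z sZ cZ].
have vZ z : z \in Z -> E v z by move=> /(subsetP sZ)/(subsetP sY); rewrite inE.
apply: (@no_source (v |: Z) _ _ v).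
- move=> x y; rewrite !inE => /orP[/eqP->|xZ] /orP[/eqP->|yZ]; rewrite ?eqxx //.
  + by rewrite /adj vZ.
  + by rewrite /adj vZ ?orbT.
  + by apply: cY; apply: (subsetP sZ).
- by rewrite cardsU1 cZ addnC; case: (boolP (v \in Z)) => // /vZ; rewrite (negPf (Eirr v)).
- by split=> [|u]; rewrite ?setU11 // !inE => /orP[->//|/vZ].
Qed.

(** For each subset of [A], put into [B] the vertices dominating it, if its size is at least [tp],
    and those nonadjacent to it, if its size is [lam]. The failure of [returning] bounds the former
    by [N], spreadness at [x] the latter by [lam]. *)
Lemma exceptional_out_neighbours (W A : {set T}) x tp N :
  A \subset inN E x ->
  ~~ [exists U : {set T}, [exists A' : {set T},
      [&& U \subset outN E x :&: W, N <= #|U|, A' \subset A, tp <= #|A'|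
        & complete E U A']]] ->
  exists B : {set T}, [/\ #|B| <= 2 ^ #|A| * (N + lam), B \subset outN E x :&: W &
    {in outN E x :&: W, forall y, y \notin B ->
      #|[set a in A | ~~ E a y]| <= tp + lam}].
Proof.
move=> sA noU.
pose F (A' : {set T}) := [set y in outN E x :&: W | (tp <= #|A'|) && (A' \subset outN E y)].
pose G (L : {set T}) :=
  [set y in outN E x :&: W | (#|L| == lam) && [forall a in L, ~~ adj E a y]].
exists ((\bigcup_(A' in powerset A) F A') :|: \bigcup_(L in powerset A) G L); split.
- rewrite mulnDr -card_powerset.
  apply: leq_trans (leq_card_setU _ _) _; apply: leq_add; apply: card_bigcup_le.
    move=> A'; rewrite inE => sA'; case: (leqP tp #|A'|) => tpA'; last first.
      apply: leq_trans (leq0n N); rewrite leqn0 cards_eq0; apply/eqP/setP => y.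
      by rewrite !inE leqNgt tpA' andbF.
    rewrite leqNgt; apply: contra noU => /ltnW NF.
    apply/existsP; exists (F A'); apply/existsP; exists A'; rewrite sA' tpA' NF /=.
    apply/andP; split; first by apply/subsetP => y; rewrite inE => /andP[].
    by apply/forall_inP => y; rewrite inE => /and3P[].
  move=> L; rewrite inE => sL; case: (eqVneq #|L| lam) => cL; last first.
    apply: leq_trans (leq0n lam); rewrite leqn0 cards_eq0; apply/eqP/setP => y.
    by rewrite !inE (negPf cL) andbF.
  rewrite leqNgt; apply/negP => /ltnW lamG.
  suff : #|L| < lam by rewrite cL ltnn.
  apply: (spread_nonadj Espread (v := x) (U := G L)) => //.
  + by apply/subsetP => y; rewrite inE => /andP[/setIP[]].
  + exact: subset_trans sL sA.
  + by move=> a y aL; rewrite inE => /and3P[_ _ /forall_inP]; apply.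
- rewrite subUset; apply/andP; split; apply/bigcupsP => Y _;
  by apply/subsetP => y; rewrite inE => /andP[].
move=> y yx; rewrite inE => /norP[yF yG].
apply: leq_trans (_ : #|[set a in A | E y a]| + #|[set a in A | ~~ adj E a y]| <= _).
  apply: leq_trans (leq_card_setU _ _); apply/subset_leq_card/subsetP => a.
  by rewrite !inE /adj => /andP[->]; case: (E a y); case: (E y a).
apply: leq_add.
  rewrite leqNgt; apply: contra yF => /ltnW tpA; apply/bigcupP.
  exists [set a in A | E y a]; first by rewrite inE; apply/subsetP => a; rewrite inE => /andP[].
  rewrite inE yx tpA /=; apply/subsetP => a; by rewrite !inE => /andP[].
rewrite leqNgt; apply: contra yG => /ltnW/subset_of_card[L sL cL]; apply/bigcupP.
exists L.
  by rewrite inE; apply: subset_trans sL _; apply/subsetP => a; rewrite inE => /andP[].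
rewrite inE yx cL eqxx /=; apply/forall_inP => a /(subsetP sL).
by rewrite inE => /andP[].
Qed.

(* A clique [X] avoiding [B] has a vertex [a] dominating [x] and [X :&: outN E x],
   so the out-degree of [x] in [X] is one below the bound [(kappa.+1)./2 - 1]
   valid for all vertices of [X], and the out-degrees do not sum up to
   [kappa * (kappa - 1) / 2]. *)
Lemma exceptional_set (W : {set T}) x t tp N :
  kappa * (tp + lam) < t -> ~~ returning E t tp N W x ->
  exists B : {set T}, [/\ #|B| <= t + 2 ^ t * (N + lam), x \notin B &
    forall X : {set T}, X \subset W -> clique E X -> #|X| = kappa -> x \in X ->
      ~~ [disjoint X & B]].
Proof.
move=> lt_t; rewrite /returning negb_and; case/orP.
  (* With few in-neighbours, [B] consists of all of them: a clique containing [x] and avoiding [B]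
     has [x] as a source. *)
  rewrite -ltnNge => few; exists (inN E x :&: W); split.
  - exact: leq_trans (ltnW few) (leq_addr _ _).
  - by rewrite !inE (negPf (Eirr x)).
  move=> X sX cX sizeX xX; apply/negP => disj.
  have : #|X :\ x| < (kappa.+1)./2.
    apply: (@out_clique_small _ x); first exact: clique_sub (subsetDl _ _) cX.
    apply/subsetP => y; rewrite !inE => /andP[ynx yX].
    have := cX y x yX xX ynx; rewrite /adj => /orP[yx|//].
    by have := disjointFr disj yX; rewrite !inE yx (subsetP sX).
  by have := cardsD1 x X; rewrite xX sizeX; move: kappa_ge2; clear; lia.
rewrite negb_forall_in => /exists_inP[A /andP[/subsetIP[sA _] /eqP cA] noU].
have [B [cB sB domB]] := exceptional_out_neighbours sA noU.
exists B; split.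
- by rewrite -cA (leq_trans cB) ?leq_addl.
- by apply/negP => /(subsetP sB); rewrite !inE (negPf (Eirr x)).
move=> X sX cX sizeX xX; apply/negP => disj.
pose Y := X :&: outN E x.
have sYX : Y \subset X by apply: subsetIl.
(* Each [y] in [Y] rules out at most [tp + lam] elements of [A], and [#|Y|] is at most [kappa], so
   the bound on [t] leaves some [a]. *)
have [a aA aY] : exists2 a, a \in A & {in Y, forall y, E a y}.
  pose D := \bigcup_(y in Y) [set a in A | ~~ E a y].
  have cD : #|D| < #|A|.
    rewrite cA; apply: leq_ltn_trans lt_t; apply: leq_trans (_ : #|Y| * (tp + lam) <= _).
      apply: card_bigcup_le => y; rewrite inE => /andP[yX yx]; apply: domB.
        by rewrite inE yx (subsetP sX).
      by rewrite (disjointFr disj).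
    by rewrite leq_mul2r -sizeX subset_leq_card ?orbT.
  have /subsetPn[a aA aD] : ~~ (A \subset D).
    by apply: contraL cD => /subset_leq_card; rewrite -leqNgt.
  exists a => // y yY; apply: contraNT aD => ay.
  by apply/bigcupP; exists y => //; rewrite inE aA.
have cY : #|Y|.+1 < (kappa.+1)./2.
  have xY : x \notin Y by rewrite !inE (negPf (Eirr x)) andbF.
  have := @out_clique_small (x |: Y) a; rewrite cardsU1 xY; apply.
    by apply: clique_sub cX; rewrite subUset sub1set xX.
  rewrite subUset sub1set inE; apply/andP; split.
    by have := subsetP sA a aA; rewrite inE.
  by apply/subsetP => y yY; rewrite inE aY.
have := clique_out_degrees cX; rewrite (bigD1 x) //= -/Y sizeX.
have : \sum_(y in X | y != x) #|X :&: outN E y| <= kappa.-1 * ((kappa.+1)./2).-1.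
  rewrite -{1}sizeX (cardsD1 x X) xX /= -sum_nat_const.
  rewrite (eq_bigl (fun y => y \in X :\ x)); last by move=> y; rewrite !inE andbC.
  apply: leq_sum => y _; have : #|X :&: outN E y| < (kappa.+1)./2.
    apply: (@out_clique_small _ y); last exact: subsetIr.
    exact: clique_sub (subsetIl _ _) cX.
  by clear; lia.
have : 2 * (kappa.+1)./2 <= kappa.+1 by clear; lia.
move: cY kappa_ge2; move: (\sum_(_ in _ | _) _) #|Y| (_./2); clear.
case: kappa => // k s p [|[|q]] //=; nia.
Qed.

(** The colouring need not be proper: [x] only receives a colour missing on its exceptional set,
    which every [kappa]-clique through [x] meets. *)
Lemma clique_free_coloring t tp N :
  kappa * (tp + lam) < t ->
  (forall W : {set T}, W != set0 -> exists2 x, x \in W & ~~ returning E t tp N W x) ->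
  let C := t + 2 ^ t * (N + lam) in
  forall W : {set T}, exists f : T -> nat, (forall x, f x <= C) /\
    forall (X : {set T}) c, X \subset W -> clique E X -> {in X, forall x, f x = c} ->
      #|X| <> kappa.
Proof.
move=> lt_t nonret C W; have [n leW] := ubnP #|W|; elim: n W leW => // n IHn W leW.
have [->|W0] := eqVneq W set0.
  exists (fun=> 0); split=> // X c; rewrite subset0 => /eqP-> _ _.
  by rewrite cards0 => eq0; move: kappa_ge2; rewrite -eq0.
have [x xW /(exceptional_set lt_t)[B [cB xB hitB]]] := nonret W W0.
have [|f [fC fK]] := IHn (W :\ x).
  by have := cardsD1 x W; rewrite xW; move: leW; clear; lia.
have [i iB] : exists i : 'I_C.+1, i \notin [set inord (f b) | b in B].
  have /subsetPn[i _ iB] : ~~ ([set: 'I_C.+1] \subset [set inord (f b) | b in B]).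
    apply/negP => /subset_leq_card; rewrite cardsT card_ord leqNgt => /negP; apply.
    exact: leq_ltn_trans (leq_imset_card _ _) (leq_ltn_trans cB (ltnSn _)).
  by exists i.
exists (fun y => if y == x then i : nat else f y); split=> [y|X c sX cX fX sizeX].
  by case: ifP => // _; rewrite -ltnS.
case: (boolP (x \in X)) => xX; last first.
  apply: (fK X c) => // [|y yX].
    by apply/subsetP => y yX; rewrite !inE (subsetP sX) // (memPn xX).
  by rewrite -(fX y yX) ifN // (memPn xX).
have := hitB X sX cX sizeX xX; rewrite -setI_eq0 => /set0Pn[y /setIP[yX yB]].
have ynx : y != x by apply: contraNneq xB => <-.
have := fX x xX; have := fX y yX; rewrite eqxx (negPf ynx) => fyc ic.
move/negP: iB; apply; apply/imsetP; exists y => //.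
by apply: val_inj; rewrite /= inordK ?ltnS ?fC // fyc.
Qed.

End Sources.

(** * Choice of constants and the final colouring *)

Theorem theorem3p9 (kappa lam tau : nat) (hkappa : 2 <= kappa)
  (htau : forall (J : finType) (EJ : rel J), digraph EJ -> spread EJ lam ->
            omega_lt EJ kappa -> colorable EJ setT tau) :
  let Lam := 2 * lam ^ 2 + lam in
  exists k1 c1 : nat,
    forall (T : finType) (E : rel T),
      digraph E -> robust E (4 * Lam * tau) k1 -> spread E lam ->
      omega_lt E kappa.+1 ->
      (forall X : {set T}, clique E X -> #|X| = (kappa.+1)./2 + 1 ->
         forall v, ~ source_of E X v) ->
      colorable E setT c1.
Proof.
move=> Lam.
(* [tp] pays for [kappa] extensions and for a part of a cyclic triple; [t] exceeds
   [kappa * (tp + lam)]; [N] yields [t] vertices homogeneous to [kappa * t] others; [C] bounds the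
   exceptional sets. *)
pose tp := 4 * lam * kappa + 3 * lam + 1.
pose t := kappa * (tp + lam) + tp + 1.
pose N := t * (2 ^ (kappa * t) * 2 ^ (kappa * t)).
pose C := t + 2 ^ t * (N + lam).
exists (lam * (2 ^ (9 * lam) * 2 ^ (9 * lam))), (C.+1 * tau).
move=> T E Edi Erob Espread Eomega no_source; have [Eirr _] := Edi.
(* For [lam = 0], spreadness at any vertex fails on empty sets, so there are no vertices. *)
case: (posnP lam) => [lam0|lam_gt0].
  have void (x : T) : False.
    by have [||||a [b [+ _ _]]] := Espread x set0 set0; rewrite ?sub0set ?cards0 ?lam0 ?inE.
  by exists (fun=> 0); split=> x; case: (void x).
(* A [kappa]-clique among the neighbours of [v] would extend by [v]. *)
have colN v : colorable E (inN E v :|: outN E v) tau.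
  apply: (induced_colorable Edi htau Espread) => X sX cX.
  have adjv y : y \in X -> adj E v y.
    by move=> /(subsetP sX); rewrite !inE /adj orbC.
  have vX : v \notin X by apply/negP => /adjv; rewrite /adj (negPf (Eirr v)).
  have := Eomega (v |: X); rewrite cardsU1 vX ltnS; apply.
  move=> x y; rewrite !inE => /orP[/eqP->|xX] /orP[/eqP->|yX]; rewrite ?eqxx //.
  - by move=> _; apply: adjv.
  - by move=> _; rewrite adjC; apply: adjv.
  - exact: cX.
have acyclic (A B D : {set T}) : complete E A B -> complete E B D -> complete E D A ->
    3 * lam <= #|A| -> 3 * lam <= #|B| -> 3 * lam <= #|D| -> False.
  apply: (no_cyclic_triple Espread lam_gt0 colN _ (leqnn _) Erob).
  (* For positive [lam], [4 * Lam] is at least [12 * lam]. *)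
  by rewrite leq_mul2r /Lam; apply/orP; right; move: lam_gt0; clear; nia.
have nonret (W : {set T}) : W != set0 -> exists2 x, x \in W & ~~ returning E t tp N W x.
  move=> W0; apply/exists_inP; rewrite -negb_forall_in; apply/negP => /forall_inP retW.
  have [|||K [/Eomega + cK]] :=
      returning_clique Espread acyclic _ _ (leqnn N) Eirr (ltnW hkappa) _ W0 retW.
  - by rewrite /tp; clear; lia.
  - by rewrite /t; clear; lia.
  - by rewrite /tp; clear; lia.
  by rewrite cK ltnn.
have lt_t : kappa * (tp + lam) < t by rewrite /t; clear; lia.
have [f [fC fK]] := clique_free_coloring Eirr Espread hkappa no_source lt_t nonret [set: T].
have := @colorable_bigcup T E _ (enum 'I_C.+1) (fun c => [set x | f x == c]) tau.
rewrite size_enum_ord big_enum => col; apply: colorable_sub (leqnn _) (col _).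
  by apply/subsetP => x _; apply/bigcupP; exists (Ordinal (fC x : f x < C.+1)); rewrite ?inE.
move=> c _; apply: (induced_colorable Edi htau Espread) => X sX cX.
(* [fK] excludes size exactly [kappa], so a larger clique is trimmed first. *)
rewrite ltnNge; apply/negP => /subset_of_card[Y sY cY].
apply: (fK Y c) cY; first exact: subsetT.
  exact: clique_sub cX.
by move=> y /(subsetP sY)/(subsetP sX); rewrite inE => /eqP.
Qed.
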